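(* Let $G$ be a finite abelian group of order $n$ with dual group $\widehat G$, and let $F \colon \mathbb{N} \to \mathbb{N}$ be a strictly increasing function. For every $\varepsilon > 0$ and every $f \colon G \to \mathbb{C}$ there exist a positive integer $t\le \lceil 4/\varepsilon^2\rceil$ and a set $S \subseteq \widehat G$ with $|S| < F(t)$ such that for every $k \ge 2$ and every admissible $\boldsymbol{c} = (c_1, \ldots, c_k)\in\mathbb{Z}^k$ the Cayley $\boldsymbol{c}$-tensor $\tau_f$ of $f$ decomposes as $$\tau_f =\frac{1}{n} \sum_{\eta \in S}\widehat f(\eta)\,(\eta^{c_1}\otimes\cdots\otimes\eta^{c_k}) + \tau_R + \tau_Q,$$ with Cayley $\boldsymbol{c}$-tensors $\tau_R$ and $\tau_Q$ (of some functions $G\to\mathbb{C}$) satisfying $$\|\tau_R\|_F \le \varepsilon\|\tau_f\|_F \qquad\text{and}\qquad \lambda_{\max}(\tau_Q) \le \frac{\varepsilon \|\tau_f\|_F}{\sqrt{F(t+1) - F(t)}}.$$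
   Context: $\mathbb{N}=\{1,2,\ldots\}$. The dual group $\widehat G$ consists of the characters of $G$, i.e. homomorphisms $\eta\colon G\to\mathbb{T}$ into the multiplicative group $\mathbb{T}$ of complex numbers of modulus one; $\eta^{c}$ is the pointwise $c$-th power. The Fourier coefficient of $f\colon G\to\mathbb{C}$ at $\eta$ is $\widehat f(\eta)=\sum_{x\in G}f(x)\overline{\eta(x)}$ (unnormalized). For $k\ge2$, a vector $\boldsymbol{c}=(c_1,\ldots,c_k)\in\mathbb{Z}^k$ is admissible if each $c_i$ is coprime to the exponent of $G$. The Cayley $\boldsymbol{c}$-tensor of $f$ is $\tau_f\in\mathbb{C}^{G^k}$ with entries $(\tau_f)_{x_1\cdots x_k}=f(c_1x_1+\cdots+c_kx_k)$. A tensor $\tau\in\mathbb{C}^{G^k}$ acts as a $k$-linear form $\tau(\boldsymbol{u}_1,\ldots,\boldsymbol{u}_k)=\sum_{x_1,\ldots,x_k\in G}\tau_{x_1\cdots x_k}\boldsymbol{u}_1(x_1)\cdots\boldsymbol{u}_k(x_k)$ on $\mathbb{C}^G$ (no conjugation). Its top eigenvalue is $\lambda_{\max}(\tau)=\sup|\tau(\boldsymbol{u}_1,\ldots,\boldsymbol{u}_k)|$ over all $\boldsymbol{u}_1,\ldots,\boldsymbol{u}_k\in\mathbb{C}^G$ of Euclidean norm $1$ (with $\|\boldsymbol{u}\|^2=\sum_{x}|\boldsymbol{u}(x)|^2$), and $\|\tau\|_F=\bigl(\sum_{x_1,\ldots,x_k}|\tau_{x_1\cdots x_k}|^2\bigr)^{1/2}$.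 The rank-one tensor $\boldsymbol{u}_1\otimes\cdots\otimes\boldsymbol{u}_k$ has entries $\boldsymbol{u}_1(x_1)\cdots\boldsymbol{u}_k(x_k)$. *)

(* Defs.v *)
From HB Require Import structures.
From mathcomp Require Import all_boot all_order all_algebra all_fingroup.
From mathcomp Require Import all_solvable finmap complex.
From mathcomp Require Import classical_sets reals.

Set Implicit Arguments.
Unset Strict Implicit.
Unset Printing Implicit Defensive.

Import Order.TTheory GRing.Theory Num.Theory.

Local Open Scope ring_scope.

(* The modulus on [R[i]] takes values in [R[i]]; [cmod] is its R-valued form. *)
Notation cmod := ComplexField.Normc.normc.

Definition l2norm (R : realType) (I : finType) (v : {ffun I -> R[i]}) : R :=
  Num.sqrt (\sum_(i : I) cmod (v i) ^+ 2).

Section Dual.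
Variables (R : realType) (G : finZmodType).

Definition is_character (eta : {ffun G -> R[i]}) : bool :=
  [forall x, cmod (eta x) == 1] &&
  [forall x, forall y, eta (x + y) == eta x * eta y].

Definition dual : Type := {eta : {ffun G -> R[i]} | is_character eta}.

HB.instance Definition _ := Choice.on dual.

Definition dual_fun (eta : dual) : G -> R[i] := val eta.

Definition char_pow (eta : dual) (c : int) : {ffun G -> R[i]} :=
  [ffun x => dual_fun eta x ^ c].

Definition fourier (f : G -> R[i]) (eta : dual) : R[i] :=
  \sum_(x : G) f x * (dual_fun eta x)^*.

End Dual.

(* [R[i]^o] rather than [R[i]]: tensors form a vector space over [R[i]]. *)
Notation tensor R G k := {ffun {ffun 'I_k -> G} -> R[i]^o}.

Section Tensors.
Variables (R : realType) (G : finZmodType) (k : nat).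

(* The exponent is that of [G] as a group written multiplicatively, with the
   group law of [fingroup] given by the addition of [G]. *)
Definition admissible (c : 'I_k -> int) : Prop :=
  forall i, coprimez (c i) (exponent [set: G])%:Z.

Definition cayley (c : 'I_k -> int) (f : G -> R[i]) : tensor R G k :=
  [ffun x : {ffun 'I_k -> G} => f (\sum_(i < k) x i *~ c i)].

Definition rank_one (u : 'I_k -> {ffun G -> R[i]}) : tensor R G k :=
  [ffun x : {ffun 'I_k -> G} => \prod_(i < k) u i (x i)].

Definition mform (tau : tensor R G k) (u : 'I_k -> {ffun G -> R[i]}) : R[i] :=
  \sum_(x : {ffun 'I_k -> G}) tau x * \prod_(i < k) u i (x i).

(* [sup] is junk-valued on sets without a supremum; the set here is nonempty
   (as [G] is) and bounded by compactness, so this is the true supremum. *)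
Definition top_eigenvalue (tau : tensor R G k) : R :=
  sup [set cmod (mform tau u) | u in
        [set u : 'I_k -> {ffun G -> R[i]} | forall i, l2norm (u i) = 1]]%classic.

Definition frobenius (tau : tensor R G k) : R := l2norm tau.

End Tensors.

(* Main.v *)
Require Import Defs.
From mathcomp Require Import all_boot all_order all_algebra all_fingroup.
From mathcomp Require Import all_solvable finmap complex.
From mathcomp Require Import classical_sets reals.
From mathcomp Require Import mxrepresentation.

(* Fourier inversion on [G] writes [f] as a combination of characters, and the
   Cayley tensor of a character is the rank-one tensor of its powers. Sort the
   characters by decreasing modulus of the Fourier coefficient and cut the list
   at the positions [F t - 1]. The blocks between consecutive cuts are disjoint,
   so one of the first [ceil (4 / eps ^ 2)] blocks carries at most a fraction
   [eps ^ 2] of the energy: it gives [fR], what precedes it gives [S] and what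
   follows it gives [fQ]. Each coefficient of [fQ] is below all
   [F (t + 1) - F t] coefficients of the block, hence small, and Parseval turns
   this into a bound on the top eigenvalue. *)

Set Implicit Arguments.
Unset Strict Implicit.
Unset Printing Implicit Defensive.

Import Order.TTheory GRing.Theory Num.Theory.

Local Open Scope ring_scope.

(** * Arithmetic of the real-valued modulus *)

Lemma cmod_ge0 (R : realType) (z : R[i]) : 0 <= cmod z.
Proof. by case: z => a b; rewrite /= sqrtr_ge0. Qed.

(** This is the triangle inequality of [Rcomplex R], the complex numbers as a normed module over
    [R]. *)
Lemma cmod_sum (R : realType) (I : Type) (s : seq I) (P : pred I)
    (g : I -> R[i]) :
  cmod (\sum_(i <- s | P i) g i) <= \sum_(i <- s | P i) cmod (g i).
Proof. exact: (@ler_norm_sum R (Rcomplex R)). Qed.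

Lemma cmod_prod (R : realType) (I : Type) (s : seq I) (g : I -> R[i]) :
  cmod (\prod_(i <- s) g i) = \prod_(i <- s) cmod (g i).
Proof.
by apply: (big_morph (fun z : R[i] => cmod z)) => [x y|];
   rewrite ?ComplexField.Normc.normcM ?ComplexField.Normc.normc1.
Qed.

Lemma cmodX (R : realType) (z : R[i]) n : cmod (z ^+ n) = cmod z ^+ n.
Proof.
elim: n => [|n IHn]; first by rewrite !expr0 ComplexField.Normc.normc1.
by rewrite !exprS ComplexField.Normc.normcM IHn.
Qed.

Lemma cmod_nat (R : realType) n : cmod (n%:R : R[i]) = n%:R.
Proof.
by apply: complexI; rewrite rmorph_nat; exact: normr_nat.
Qed.

Lemma cmod_sqr (R : realType) (z : R[i]) :
  (cmod z ^+ 2)%:C%C = z * z^*.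
Proof. by rewrite -normCK rmorphXn. Qed.

(** * Characters, their orthogonality and their number *)

Section Characters.
Variables (R : realType) (G : finZmodType).
Implicit Type eta : dual R G.

Lemma dual_cmod eta x : cmod (dual_fun eta x) = 1.
Proof. by have /andP[/forallP/(_ x)/eqP] := valP eta. Qed.

Lemma dualD eta x y : dual_fun eta (x + y) = dual_fun eta x * dual_fun eta y.
Proof. by have /andP[_ /forallP/(_ x)/forallP/(_ y)/eqP] := valP eta. Qed.

Lemma dual_neq0 eta x : dual_fun eta x != 0.
Proof.
apply/eqP => e0; have := dual_cmod eta x.
by rewrite e0 ComplexField.Normc.normc0 => /esym/eqP; rewrite oner_eq0.
Qed.

Lemma dual0 eta : dual_fun eta 0 = 1.
Proof.
by apply: (mulfI (dual_neq0 eta 0)); rewrite -dualD addr0 mulr1.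
Qed.

Lemma dualN eta x : dual_fun eta (- x) = (dual_fun eta x)^-1.
Proof.
apply: (mulfI (dual_neq0 eta x)).
by rewrite -dualD subrr dual0 mulfV ?dual_neq0.
Qed.

Lemma dualMz eta x (c : int) : dual_fun eta (x *~ c) = dual_fun eta x ^ c.
Proof.
have dualMn n : dual_fun eta (x *+ n) = dual_fun eta x ^+ n.
  by elim: n => [|n IHn]; rewrite ?dual0 // mulrS exprS dualD IHn.
case: c => n /=; first by rewrite -pmulrn dualMn.
by rewrite NegzE mulrNz -pmulrn dualN dualMn.
Qed.

Lemma dual_sum eta (I : Type) (s : seq I) (g : I -> G) :
  dual_fun eta (\sum_(i <- s) g i) = \prod_(i <- s) dual_fun eta (g i).
Proof. by apply: big_morph; [exact: dualD|exact: dual0]. Qed.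

Lemma dual_conj eta x : (dual_fun eta x)^* = dual_fun eta (- x).
Proof.
apply: (mulfI (dual_neq0 eta x)).
by rewrite -dualD subrr dual0 -cmod_sqr dual_cmod expr1n.
Qed.

(** Translating the summation variable by [y] multiplies the sum by [eta1 y] times the conjugate of
    [eta2 y]. This factor differs from 1 where the two characters differ, so the sum is then
    zero. *)
Lemma dual_orthogonal eta1 eta2 :
  \sum_x dual_fun eta1 x * (dual_fun eta2 x)^* = (#|G| * (eta1 == eta2))%:R.
Proof.
have [->|neq12] := eqVneq eta1 eta2.
  under eq_bigr do rewrite dual_conj -dualD subrr dual0.
  by rewrite sumr_const muln1.
set T := LHS; have [y] : exists y, dual_fun eta1 y != dual_fun eta2 y.
  apply/existsP; apply: contraNT neq12 => /existsPn eq12.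
  by apply/eqP/val_inj/ffunP => x; apply/eqP; have := eq12 x; rewrite negbK.
rewrite muln0; apply: contraNeq => T0; apply/eqP.
have : dual_fun eta1 y * (dual_fun eta2 y)^* * T = 1 * T.
  rewrite mul1r [RHS](reindex_inj (addrI y)) mulr_sumr; apply: eq_bigr => x _.
  by rewrite !dual_conj opprD !dualD mulrACA.
move/(mulIf T0)/(congr1 (fun z => z * dual_fun eta2 y)).
by rewrite dual_conj dualN mulfVK ?dual_neq0 // mul1r.
Qed.

(* In characteristic 0 over an algebraically closed field, an abelian group has
   as many irreducible representations as elements, all of degree 1. *)
Lemma dual_enum : exists s : #|G|.-tuple (dual R G), uniq s.
Proof.
have cGG : abelian [set: G].
  by apply/centsP => x _ y _; rewrite /commute !FinRing.zmodMgE addrC.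
have splitG : group_splitting_field R[i] [set: G]%G.
  exact: group_closure_closed_field.
have F'G : ([pchar R[i]]^')%g.-group%g [set: G].
  by apply/pgroupP => p _ _; rewrite inE /= pchar_num.
have sG : irrType R[i] [set: G]%G by apply: DecSocleType.
have center x : x \in 'Z([set: G])%g by rewrite (center_idP cGG) inE.
pose eta_fun (i : sG) : {ffun G -> R[i]} := [ffun x => irr_mode i x].
have is_char i : is_character (eta_fun i).
  apply/andP; split; apply/forallP => x.
    (* As [x] has finite order, its value is a root of unity, so a positive power of the modulus is
       1. *)
    rewrite ffunE -(@pexpr_eq1 _ _ #[x]%g) ?cmod_ge0 ?order_gt0 //.
    rewrite -cmodX -irr_modeX // expg_order irr_mode1.
    by rewrite ComplexField.Normc.normc1.
  by apply/forallP => y; rewrite !ffunE -FinRing.zmodMgE irr_modeM.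
pose eta i : dual R G := Sub (eta_fun i) (is_char i).
have inj_eta : injective eta.
  move=> i j /(congr1 val) /ffunP eq_ij.
  rewrite -(irr_reprK_pchar F'G i) -(irr_reprK_pchar F'G j).
  have scal (l : sG) (x : G) : irr_repr l x = (irr_mode l x)%:M.
    exact: (irr_center_scalar splitG).
  move: (irr_repr i) (irr_repr j) (scal i) (scal j).
  rewrite !(irr_degree_abelian splitG cGG) => rI rJ rIx rJx.
  apply: irr_comp_rsim_pchar => //.
  (* Both representations are scalar of degree 1 with the same values, so the identity matrix
     intertwines them. *)
  exists 1%:M; rewrite ?row_free_unit ?unitmx1 // => x _.
  by rewrite mulmx1 mul1mx rIx rJx; have := eq_ij x; rewrite !ffunE => ->.
have sz : size [seq eta i | i <- enum sG] == #|G|.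
  rewrite size_map -cardE (card_irr_pchar sG F'G splitG) -cardsT.
  by rewrite -card_classes_abelian.
by exists (Tuple sz); rewrite //= map_inj_uniq ?enum_uniq.
Qed.

End Characters.

(** Expand the square into a double sum; orthogonality leaves only the diagonal. It is applied with
    [M] indexed by characters and group elements, in either order. *)
Lemma sum_sqr_orthogonal (R : realType) (I : Type) (J : eqType) (r : seq I)
    (t : seq J) (M : I -> J -> R[i]) (a : J -> R[i]) (N : nat) :
    uniq t ->
    (forall j k, \sum_(i <- r) M i j * (M i k)^* = (N * (j == k))%:R) ->
  \sum_(i <- r) cmod (\sum_(j <- t) a j * M i j) ^+ 2
    = N%:R * \sum_(j <- t) cmod (a j) ^+ 2.
Proof.
move=> t_uniq orthM; apply: complexI.
rewrite rmorphM rmorph_nat !rmorph_sum /= mulr_sumr.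
transitivity (\sum_(j <- t) \sum_(k <- t)
    a j * (a k)^* * \sum_(i <- r) M i j * (M i k)^*).
  under eq_bigr => i _ do rewrite cmod_sqr rmorph_sum big_distrlr /=.
  rewrite exchange_big; apply: eq_bigr => j _ /=.
  rewrite exchange_big; apply: eq_bigr => k _ /=.
  by rewrite mulr_sumr; apply: eq_bigr => i _; rewrite rmorphM mulrACA.
apply: eq_big_seq => j jt; rewrite (bigD1_seq j) //=.
rewrite [X in _ + X]big1 => [|k neq_kj].
  by rewrite addr0 orthM eqxx muln1 cmod_sqr mulrC.
by rewrite orthM eq_sym (negPf neq_kj) muln0 mulr0.
Qed.

(** * Fourier inversion and Parseval *)

Section Fourier.
Variables (R : realType) (G : finZmodType) (s : #|G|.-tuple (dual R G)).
Hypothesis s_uniq : uniq s.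

Let cardG_gt0 : (0 < #|G|)%N.
Proof. by apply/card_gt0P; exists 0. Qed.

Let cardG_neq0 : #|G|%:R != 0 :> R[i].
Proof. by rewrite pnatr_eq0 -lt0n. Qed.

(** With [#|G|] distinct characters the character table is square. Row orthogonality gives it a
    right inverse, which is then also a left inverse, and this is column orthogonality. *)
Lemma dual_complete x y :
  \sum_(eta <- s) dual_fun eta x * (dual_fun eta y)^* = (#|G| * (x == y))%:R.
Proof.
pose U : 'M[R[i]]_#|G| := \matrix_(i, j) dual_fun (tnth s i) (enum_val j).
pose V : 'M[R[i]]_#|G| :=
  \matrix_(j, i) ((#|G|%:R)^-1 * (dual_fun (tnth s i) (enum_val j))^*).
have UV : U *m V = 1%:M.
  apply/matrixP => i j; rewrite !mxE.
  under eq_bigr do rewrite !mxE mulrCA.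
  rewrite -mulr_sumr.
  rewrite -(big_enum_val (fun x => dual_fun (tnth s i) x *
     (dual_fun (tnth s j) x)^*)) dual_orthogonal natrM mulKf //.
  by rewrite -(inj_eq (tuple_uniqP s s_uniq)).
have /matrixP/(_ (enum_rank y) (enum_rank x)) := mulmx1C UV.
rewrite !mxE => VU.
rewrite big_tuple natrM eq_sym -(inj_eq enum_rank_inj) -VU mulr_sumr.
by apply: eq_bigr => i _; rewrite !mxE !enum_rankK mulrA mulVKf // mulrC.
Qed.

(** The map [phi] is there for multiplication by an admissible [c i], which replaces [eta] by its
    power. *)
Lemma dual_parseval (phi : G -> G) (u : G -> R[i]) :
    injective phi ->
  \sum_(eta <- s) cmod (\sum_x u x * dual_fun eta (phi x)) ^+ 2
    = #|G|%:R * \sum_x cmod (u x) ^+ 2.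
Proof.
move=> phi_inj; apply: sum_sqr_orthogonal; first exact: index_enum_uniq.
by move=> x y; rewrite dual_complete (inj_eq phi_inj).
Qed.

(** The share of [f] in the inversion formula carried by the characters in [t]. All three terms of
    the decomposition come from functions of this form. *)
Definition fourier_part (f : G -> R[i]) (t : seq (dual R G)) (x : G) : R[i] :=
  #|G|%:R^-1 * \sum_(eta <- t) fourier f eta * dual_fun eta x.

Lemma fourier_inversion f x : f x = fourier_part f s x.
Proof.
apply: (mulfI cardG_neq0); rewrite mulVKf //.
under eq_bigr do rewrite mulr_suml.
rewrite exchange_big (bigD1 x) //= [X in _ + X]big1 => [|y neq_yx].
  under eq_bigr do rewrite -mulrA [_^* * _]mulrC.
  by rewrite -mulr_sumr dual_complete eqxx muln1 addr0 mulrC.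
under eq_bigr do rewrite -mulrA [_^* * _]mulrC.
by rewrite -mulr_sumr dual_complete eq_sym (negPf neq_yx) muln0 mulr0.
Qed.

Lemma fourier_part_sqr f t :
    uniq t ->
  \sum_x cmod (fourier_part f t x) ^+ 2
    = #|G|%:R^-1 * \sum_(eta <- t) cmod (fourier f eta) ^+ 2.
Proof.
move=> t_uniq; have n0 : #|G|%:R != 0 :> R by rewrite pnatr_eq0 -lt0n.
(* The first factor [#|G|] clears the inverse on the right; the second gives the right-hand side of
   [sum_sqr_orthogonal]. *)
apply: (mulfI n0); rewrite mulVKf //; apply: (mulfI n0).
rewrite -(@sum_sqr_orthogonal _ _ _ (index_enum G) t
  (fun x eta => dual_fun eta x)) //; last first.
  by move=> eta1 eta2; apply: dual_orthogonal.
rewrite mulrA mulr_sumr; apply: eq_bigr => x _.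
rewrite ComplexField.Normc.normcM ComplexField.Normc.normcV cmod_nat.
by rewrite exprMn mulrA -expr2 -exprMn mulfV // expr1n mul1r.
Qed.

End Fourier.

(** In a Bezout relation [u * c + v * e = 1] with the exponent [e], the second term kills [G], so
    multiplication by [u] undoes multiplication by [c]. *)
Lemma mulrz_coprime_inj (G : finZmodType) (c : int) :
  coprimez c (exponent [set: G])%:Z -> injective (fun x : G => x *~ c).
Proof.
case/coprimezP => -[u v] /= bezout.
have cK : cancel (fun x : G => x *~ c) (fun y => y *~ u).
  move=> x; have xe0 : x *~ (exponent [set: G])%:Z = 0.
    by rewrite -pmulrn -FinRing.zmodXgE expg_exponent ?inE.
  rewrite -[RHS]mulr1z -bezout mulrzDr [u * c]mulrC [v * _]mulrC.
  by rewrite !mulrzA xe0 mul0rz addr0.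
exact: can_inj cK.
Qed.

(** * Frobenius norm and multilinear form of Cayley tensors *)

Section Cayley.
Variables (R : realType) (G : finZmodType).

Lemma l2norm_sqr (I : finType) (v : {ffun I -> R[i]}) :
  l2norm v ^+ 2 = \sum_i cmod (v i) ^+ 2.
Proof.
by rewrite sqr_sqrtr ?sumr_ge0 // => i _; rewrite exprn_ge0 ?cmod_ge0.
Qed.

(* Translating the first coordinate by [y] shifts the argument of [h] by
   [y *~ c ord0], which ranges over the whole group. *)
Lemma sum_cayley k (c : 'I_k.+1 -> int) (h : G -> R) :
    injective (fun x : G => x *~ c ord0) ->
  \sum_(x : {ffun 'I_k.+1 -> G}) h (\sum_i x i *~ c i)
    = #|G|%:R ^+ k * \sum_y h y.
Proof.
move=> c0_inj; have n0 : #|G|%:R != 0 :> R.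
  by rewrite pnatr_eq0 -lt0n; apply/card_gt0P; exists 0.
apply: (mulfI n0); rewrite mulrA -exprS -natrX.
transitivity (\sum_(y : G) \sum_(x : {ffun 'I_k.+1 -> G})
    h (\sum_i x i *~ c i + y *~ c ord0)).
  rewrite mulr_natl -sumr_const; apply: eq_bigr => y _.
  pose e : {ffun 'I_k.+1 -> G} := [ffun i => if i == ord0 then y else 0].
  rewrite (reindex_inj (addIr e)); apply: eq_bigr => x _; congr h.
  under eq_bigr do rewrite ffunE mulrzDl.
  rewrite big_split /=; congr (_ + _); rewrite (bigD1 ord0) //= big1 => [|i].
    by rewrite addr0 ffunE eqxx.
  by move=> /negPf i0; rewrite ffunE i0 mul0rz.
have -> : (#|G| ^ k.+1 = #|{ffun 'I_k.+1 -> G}|)%N.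
  by rewrite card_ffun card_ord.
rewrite exchange_big /= mulr_natl -sumr_const.
apply: eq_bigr => x _; 
rewrite [RHS](reindex_inj (addrI (\sum_i x i *~ c i))).
by rewrite [RHS](reindex_inj c0_inj).
Qed.

Lemma frobenius_cayley k (c : 'I_k.+1 -> int) (g : G -> R[i]) :
    injective (fun x : G => x *~ c ord0) ->
  frobenius (cayley c g)
    = Num.sqrt (#|G|%:R ^+ k * \sum_y cmod (g y) ^+ 2).
Proof.
move=> c0_inj; rewrite -(sum_cayley (fun y => cmod (g y) ^+ 2) c0_inj).
by congr Num.sqrt; apply: eq_bigr => x _; rewrite ffunE.
Qed.

Lemma cayley_dual k (c : 'I_k -> int) (eta : dual R G) :
  cayley c (dual_fun eta) = rank_one (fun i => char_pow eta (c i)).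
Proof.
apply/ffunP => x; rewrite !ffunE dual_sum; apply: eq_bigr => i _.
by rewrite ffunE dualMz.
Qed.

Lemma cayley_fourier_part k (c : 'I_k -> int) (f : G -> R[i]) t :
  cayley c (fourier_part f t) = (#|G|%:R : R[i])^-1 *:
    (\sum_(eta <- t) fourier f eta *: rank_one (fun i => char_pow eta (c i))).
Proof.
apply/ffunP => x; rewrite !ffunE; congr (_ * _).
rewrite sum_ffunE; apply: eq_bigr => eta _.
by rewrite -cayley_dual !ffunE.
Qed.

Lemma mform_rank_one k (v u : 'I_k -> {ffun G -> R[i]}) :
  mform (rank_one v) u = \prod_i \sum_x u i x * v i x.
Proof.
rewrite bigA_distr_bigA; apply: eq_bigr => x _.
by rewrite ffunE -big_split; apply: eq_bigr => i _; rewrite mulrC.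
Qed.

(** The powers of [eta] are moved into the argument as [x *~ c i], the shape to which
    [dual_parseval] applies. *)
Lemma mform_fourier_part k (c : 'I_k -> int) (f : G -> R[i]) t u :
  mform (cayley c (fourier_part f t)) u = #|G|%:R^-1 *
    \sum_(eta <- t) fourier f eta *
      \prod_i \sum_x u i x * dual_fun eta (x *~ c i).
Proof.
transitivity (#|G|%:R^-1 * \sum_(eta <- t) fourier f eta *
    mform (rank_one (fun i => char_pow eta (c i))) u).
  rewrite cayley_fourier_part /mform.
  under [in RHS]eq_bigr do rewrite mulr_sumr.
  rewrite exchange_big mulr_sumr; apply: eq_bigr => x _.
  rewrite ffunE sum_ffunE. rewrite -scalerAl mulr_suml; congr (_ * _).
  by apply: eq_bigr => eta _; rewrite ffunE mulrA.
congr (_ * _); apply: eq_bigr => eta _; rewrite mform_rank_one.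
congr (_ * _); apply: eq_bigr => i _; apply: eq_bigr => x _.
by rewrite ffunE dualMz.
Qed.

End Cayley.

(* All but two factors are bounded by [Num.sqrt N], and AM-GM applies to the
   remaining two. *)
Lemma sum_prod_le (R : rcfType) (T : eqType) (s : seq T) k
    (b : 'I_k.+2 -> T -> R) (N : R) :
    (forall i x, 0 <= b i x) ->
    (forall i, \sum_(x <- s) b i x ^+ 2 <= N) ->
  \sum_(x <- s) \prod_i b i x <= N * Num.sqrt N ^+ k.
Proof.
move=> b_ge0 sumb.
have b_le i x : x \in s -> b i x <= Num.sqrt N.
  move=> xs; rewrite -(ger0_norm (b_ge0 i x)) -sqrtr_sqr ler_wsqrtr //.
  apply: le_trans (sumb i); rewrite (big_rem x) //= lerDl.
  by rewrite sumr_ge0 // => y _; rewrite exprn_ge0.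
pose i1 : 'I_k.+2 := lift ord0 ord0.
have prod_le x : x \in s ->
    \prod_i b i x <= (b ord0 x ^+ 2 + b i1 x ^+ 2) / 2 * Num.sqrt N ^+ k.
  move=> xs; rewrite !big_ord_recl mulrA ler_pM ?mulr_ge0 ?prodr_ge0 //.
    rewrite ler_pdivlMr // -subr_ge0.
    suff -> : b ord0 x ^+ 2 + b i1 x ^+ 2 - b ord0 x * b i1 x * 2
      = (b ord0 x - b i1 x) ^+ 2 by rewrite sqr_ge0.
    by rewrite sqrrB mulr_natr addrAC.
  rewrite -[X in _ ^+ X]card_ord -prodr_const.
  by apply: ler_prod => i _; rewrite b_ge0 b_le.
rewrite big_seq; apply: le_trans (ler_sum _ prod_le) _.
rewrite -big_seq -mulr_suml ler_wpM2r ?exprn_ge0 ?sqrtr_ge0 //.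
by rewrite -mulr_suml big_split /= ler_pdivrMr // mulr_natr mulr2n lerD.
Qed.

Lemma ler_sum_uniq_sub (R : numDomainType) (T : eqType) (s t : seq T)
    (g : T -> R) :
    (forall x, 0 <= g x) -> uniq s -> uniq t -> {subset t <= s} ->
  \sum_(x <- t) g x <= \sum_(x <- s) g x.
Proof.
move=> g_ge0 us ut ts; rewrite (perm_big [seq x <- s | x \in t]) /=; last first.
  apply: uniq_perm; rewrite ?filter_uniq // => x.
  by rewrite mem_filter andb_idr //; apply: ts.
by rewrite big_filter [leRHS](bigID (mem t)) /= lerDl sumr_ge0.
Qed.

(** Bound the coefficients by [M] and the sum of products of the transforms of the [u i] by
    [sum_prod_le], where Parseval supplies [N = #|G|]. This factor [N] cancels the normalization of
    the inversion formula. *)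
Lemma top_eigenvalue_fourier_part (R : realType) (G : finZmodType)
    (s : #|G|.-tuple (dual R G)) (t : seq (dual R G)) (f : G -> R[i]) k
    (c : 'I_k.+2 -> int) (M : R) :
    uniq s -> uniq t -> {subset t <= s} -> admissible G c -> 0 <= M ->
    (forall eta, eta \in t -> cmod (fourier f eta) <= M) ->
  top_eigenvalue (cayley c (fourier_part f t)) <= M * Num.sqrt #|G|%:R ^+ k.
Proof.
move=> us ut ts cadm M_ge0 f_le.
have n_gt0 : 0 < #|G|%:R :> R.
  by rewrite ltr0n; apply/card_gt0P; exists 0.
apply: ge_sup => [|_ [u u1 <-]].
  (* The point mass at 0 is a unit vector, so the set under the supremum is nonempty. *)
  pose d : {ffun G -> R[i]} := [ffun x => (x == 0)%:R].
  exists (cmod (mform (cayley c (fourier_part f t)) (fun=> d))).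
  exists (fun=> d) => // i; apply/eqP.
  rewrite -(@pexpr_eq1 _ _ 2) ?sqrtr_ge0 // l2norm_sqr (bigD1 0) //= big1.
    by rewrite ffunE eqxx ComplexField.Normc.normc1 expr1n addr0.
  by move=> x /negPf x0; rewrite ffunE x0 ComplexField.Normc.normc0 expr0n.
rewrite mform_fourier_part ComplexField.Normc.normcM.
rewrite ComplexField.Normc.normcV cmod_nat ler_pdivrMl // mulrCA.
pose b (i : 'I_k.+2) (eta : dual R G) : R :=
  cmod (\sum_x u i x * dual_fun eta (x *~ c i)).
have sumb i : \sum_(eta <- t) b i eta ^+ 2 <= #|G|%:R.
  apply: (@le_trans _ _ (\sum_(eta <- s) b i eta ^+ 2)).
    by apply: ler_sum_uniq_sub => // eta; rewrite exprn_ge0 ?cmod_ge0.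
  rewrite (dual_parseval us); last exact: mulrz_coprime_inj (cadm i).
  by rewrite -l2norm_sqr u1 expr1n mulr1.
apply: le_trans (cmod_sum _ _ _) _.
apply: (@le_trans _ _ (\sum_(eta <- t) M * \prod_i b i eta)).
  rewrite big_seq [leRHS]big_seq; apply: ler_sum => eta eta_t.
  rewrite ComplexField.Normc.normcM cmod_prod ler_wpM2r ?f_le //.
  by rewrite prodr_ge0 // => i _; exact: cmod_ge0.
rewrite -mulr_sumr ler_wpM2l // sum_prod_le // => i eta; exact: cmod_ge0.
Qed.

(** * Consecutive blocks of a sorted sequence *)

Section Blocks.
Variables (R : realDomainType) (T : eqType) (s : seq T) (g : T -> R).
Hypothesis g_ge0 : forall x, 0 <= g x.

Definition block m p := drop m (take p s).

Lemma cat_block m p : (m <= p)%N -> take m s ++ block m p = take p s.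
Proof. by move=> mp; rewrite -(take_takel s mp) cat_take_drop. Qed.

(** If each of the [N] disjoint blocks carried more than a fraction [1 / N] of the total, together
    they would exceed it. Block sums are differences of the prefix sums [P], so they telescope. *)
Lemma block_pigeonhole (b : nat -> nat) N :
    {homo b : m p / (m <= p)%N} -> (0 < N)%N ->
  exists2 j, (j < N)%N &
    N%:R * \sum_(x <- block (b j) (b j.+1)) g x <= \sum_(x <- s) g x.
Proof.
move=> b_homo N_gt0; pose P m := \sum_(x <- take m s) g x.
have P_ge0 m : 0 <= P m by apply: sumr_ge0.
have P_le m : P m <= \sum_(x <- s) g x.
  by rewrite /P -{2}(cat_take_drop m s) big_cat lerDl sumr_ge0.
have blockE j : \sum_(x <- block (b j) (b j.+1)) g x = P (b j.+1) - P (b j).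
  by rewrite /P -(cat_block (b_homo _ _ (leqnSn j))) big_cat addrC addKr.
have [|/existsPn all_gt] := boolP [exists j : 'I_N,
    N%:R * \sum_(x <- block (b j) (b j.+1)) g x <= \sum_(x <- s) g x].
  by case/existsP => j; exists j.
suff : \sum_(x <- s) g x *+ N < \sum_(x <- s) g x *+ N by rewrite ltxx.
have : \sum_(j < N) \sum_(x <- s) g x
    < \sum_(j < N) N%:R * \sum_(x <- block (b j) (b j.+1)) g x.
  apply: ltr_sum => [|j _]; last by rewrite ltNge all_gt.
  by apply/hasP; exists (Ordinal N_gt0); rewrite ?mem_index_enum.
rewrite sumr_const card_ord => /lt_le_trans; rewrite -sumrMnl; apply.
under eq_bigr do rewrite blockE.
rewrite -mulr_sumr mulr_natl sumrMnl lerMn2r -(big_mkord predT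
  (fun j => P (b j.+1) - P (b j))) telescope_sumr //.
by rewrite (le_trans _ (P_le (b N))) ?orbT // gerBl.
Qed.

(** Every block element precedes [x], so its value is at least [g x]. The presence of [x] after
    position [p] ensures that the block is not cut short by the end of [s]. *)
Lemma sorted_block_ge m p x :
    sorted (fun y z => g z <= g y) s -> (m <= p)%N -> x \in drop p s ->
  (p - m)%:R * g x <= \sum_(y <- block m p) g y.
Proof.
move=> s_sorted mp x_in.
have p_lt : (p < size s)%N.
  by rewrite ltnNge; apply: contraTN x_in => /drop_oversize ->.
have sz : size (block m p) = (p - m)%N by rewrite size_drop size_takel // ltnW.
rewrite -sz mulr_natl -[_ *+ _]iter_addr_0 -(count_predT (block m p)).
rewrite -big_const_seq big_seq [leRHS]big_seq; apply: ler_sum => y y_in.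
move: s_sorted; rewrite sorted_pairwise => [|y1 y2 y3 le12 le23]; last first.
  exact: le_trans le23 le12.
rewrite -(cat_take_drop p s) pairwise_cat => /and3P[/allrelP le_yx _ _].
by apply: le_yx => //; apply: mem_drop y_in.
Qed.

End Blocks.

(** * Choice of the block and assembly of the decomposition *)

Theorem corollary9 (R : realType) (G : finZmodType) (F : nat -> nat)
    (F_pos : forall m : nat, (0 < m)%N -> (0 < F m)%N)
    (F_incr : forall m p : nat, (0 < m)%N -> (m < p)%N -> (F m < F p)%N)
    (eps : R) (eps_gt0 : 0 < eps) (f : G -> R[i]) :
  exists (t : nat) (S : {fset dual R G}),
    [/\ (0 < t)%N, t%:Z <= Num.ceil (4 / eps ^+ 2), (#|` S| < F t)%N &
      forall (k : nat) (c : 'I_k -> int), (2 <= k)%N -> admissible G c ->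
        exists fR fQ : G -> R[i],
          [/\ cayley c f =
                (#|G|%:R : R[i])^-1 *:
                  (\sum_(eta <- S)
                     fourier f eta *: rank_one (fun i => char_pow eta (c i)))
                + cayley c fR + cayley c fQ,
              frobenius (cayley c fR) <= eps * frobenius (cayley c f) &
              top_eigenvalue (cayley c fQ)
                <= eps * frobenius (cayley c f)
                   / Num.sqrt ((F t.+1)%:R - (F t)%:R)]].
Proof.
have [s0 s0_uniq] := dual_enum R G.
pose g (eta : dual R G) := cmod (fourier f eta) ^+ 2.
have g_ge0 eta : 0 <= g eta by rewrite exprn_ge0 ?cmod_ge0.
pose s := sort_tuple (fun eta1 eta2 => g eta2 <= g eta1) s0.
have s_uniq : uniq s by rewrite sort_uniq.
have s_sorted : sorted (fun eta1 eta2 => g eta2 <= g eta1) s.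
  by apply: sort_sorted => eta1 eta2; apply: le_total.
pose E := \sum_(eta <- s) g eta.
have E_ge0 : 0 <= E by apply: sumr_ge0.
(* The shift of the index keeps [F] at positive arguments. The predecessor makes [#|S| < F t] strict
   and leaves the block widths unchanged. *)
pose b j := (F j.+1).-1.
have bS j : (b j).+1 = F j.+1 by rewrite prednK ?F_pos.
have b_homo : {homo b : m p / (m <= p)%N}.
  move=> m p; rewrite leq_eqVlt => /predU1P[-> // | mp].
  by rewrite -ltnS !bS ltnW // F_incr.
have ceil_gt0 : 0 < Num.ceil (4 / eps ^+ 2).
  by rewrite ceil_gt0 divr_gt0 ?exprn_gt0.
pose N := `|Num.ceil (4 / eps ^+ 2)|%N.
have NE : N%:Z = Num.ceil (4 / eps ^+ 2) by rewrite gtz0_abs.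
have N_gt0 : (0 < N)%N by rewrite -ltz_nat NE.
have [j j_lt blockE] := block_pigeonhole s g_ge0 b_homo N_gt0.
have {}blockE : \sum_(eta <- block s (b j) (b j.+1)) g eta <= eps ^+ 2 * E.
  (* Since [N >= 4 / eps ^+ 2], the fraction [1 / N] from the pigeonhole is at most [eps ^+ 2]. *)
  have N_ge : 1 <= eps ^+ 2 * N%:R :> R.
    rewrite -ler_pdivrMl ?exprn_gt0 // mulr1.
    apply: le_trans (_ : 4 / eps ^+ 2 <= _).
      by rewrite ler_peMl ?invr_ge0 ?exprn_ge0 ?ler1n // ltW.
    by rewrite -[N%:R]/(N%:Z%:~R) NE ceil_ge.
  rewrite -(ler_pM2l (_ : 0 < N%:R)) ?ltr0n // mulrA mulrC [_%:R * _]mulrC.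
  rewrite -[leLHS]mulrC; apply: le_trans blockE _.
  by rewrite -[leLHS]mul1r ler_wpM2r.
have bj : (b j <= b j.+1)%N by apply: b_homo.
pose top := take (b j) s; pose mid := block s (b j) (b j.+1).
pose low := drop (b j.+1) s.
have sE : s = (top ++ mid) ++ low :> seq _.
  by rewrite cat_block // cat_take_drop.
have [top_uniq mid_uniq low_uniq] : [/\ uniq top, uniq mid & uniq low].
  by rewrite !(take_uniq, drop_uniq).
exists j.+1, (seq_fset tt top); split=> //.
- by rewrite -NE lez_nat.
- by rewrite size_seq_fset undup_id // -bS ltnS size_take geq_minl.
(* The set and [t] are fixed before the order of the tensor and [c] appear. From here [k] is the
   order minus 2. *)
case=> [|[|k]] // c _ c_adm.
have c0_inj := mulrz_coprime_inj (c_adm ord0).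
have n_gt0 : 0 < #|G|%:R :> R.
  by rewrite ltr0n; apply/card_gt0P; exists 0.
(* All Frobenius norms carry the same factor in [k], so comparing them reduces to comparing
   energies. One of the [k.+1] factors [#|G|] is cancelled by the normalization in
   [fourier_part_sqr]. *)
have frobE t : uniq t -> frobenius (cayley c (fourier_part f t))
    = Num.sqrt (\sum_(eta <- t) g eta) * Num.sqrt #|G|%:R ^+ k.
  move=> t_uniq; rewrite frobenius_cayley // fourier_part_sqr //.
  rewrite exprSr mulrA mulfK ?gt_eqF // mulrC sqrtrM; last first.
    by apply: sumr_ge0 => eta _; exact: g_ge0.
  rewrite -[X in _ * Num.sqrt (X ^+ _)](sqr_sqrtr (ltW n_gt0)) exprAC.
  by rewrite sqrtr_sqr ger0_norm ?exprn_ge0 ?sqrtr_ge0.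
have frobf : frobenius (cayley c f) = Num.sqrt E * Num.sqrt #|G|%:R ^+ k.
  rewrite -frobE //; congr (frobenius _); apply/ffunP => x.
  by rewrite !ffunE; exact: fourier_inversion.
exists (fourier_part f mid), (fourier_part f low); split.
- rewrite (perm_big top); last first.
    by have := seq_fset_perm tt top; rewrite undup_id.
  rewrite -cayley_fourier_part; apply/ffunP => x; rewrite !ffunE.
  by rewrite (fourier_inversion s_uniq) /fourier_part sE !big_cat !mulrDr.
- rewrite frobE // frobf mulrA ler_wpM2r ?exprn_ge0 ?sqrtr_ge0 //.
  rewrite -[X in X * _](ger0_norm (ltW eps_gt0)) -sqrtr_sqr -sqrtrM ?sqr_ge0 //.
  exact: ler_wsqrtr.
have width_gt0 : 0 < (F j.+2)%:R - (F j.+1)%:R :> R.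
  by rewrite subr_gt0 ltr_nat F_incr.
have widthE : (F j.+2)%:R - (F j.+1)%:R = (b j.+1 - b j)%:R :> R.
  by rewrite -!bS natrB // -!natr1 addrAC opprD addrA subrK.
(* This exposes the coefficient bound [M], namely [eps * Num.sqrt E] over the root of the block
   width. *)
rewrite frobf mulrA mulrAC.
apply: top_eigenvalue_fourier_part s_uniq low_uniq _ c_adm _ _.
- by move=> eta; apply: mem_drop.
- by rewrite divr_ge0 ?mulr_ge0 ?sqrtr_ge0 // ltW.
move=> eta eta_low; rewrite ler_pdivlMr ?sqrtr_gt0 //.
rewrite -ler_sqr ?nnegrE ?mulr_ge0 ?cmod_ge0 ?sqrtr_ge0 ?(ltW eps_gt0) //.
rewrite !exprMn !sqr_sqrtr ?(ltW width_gt0) // mulrC widthE.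
(* After squaring, the width times the energy of [eta] is at most the energy of [mid], hence at most
   [eps ^+ 2 * E]. *)
apply: le_trans blockE; exact: sorted_block_ge s_sorted bj eta_low.
Qed.
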